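(* Let $m$ be a large positive integer (that is, $m\ge m_0$ for some absolute constant $m_0$), let $k\ge 1$ and $N\ge 1$ be integers, and let $I=[1,N]$. Let $\mathcal{P}$ be the set of prime numbers. Then the number $J_{2k}$ of solutions of the congruence $$x_1^*+\ldots+x_k^*\equiv x_{k+1}^*+\ldots+x_{2k}^*\pmod m$$ in prime numbers $x_1,\ldots,x_{2k}\in I\cap\mathcal{P}$ coprime to $m$ satisfies $$J_{2k}<(2k)^{k}\Bigl(\frac{N^{2k-1}}{m}+1\Bigr)N^{k}.$$
   Context: For an integer $x$ coprime to $m$, $x^*$ denotes the multiplicative inverse of $x$ modulo $m$. *)

(* Defs.v *)
From mathcomp Require Import all_boot.
Set Implicit Arguments.
Unset Strict Implicit.
Unset Printing Implicit Defensive.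

(* The Bezout coefficient of x is its inverse modulo m when x > 0 is coprime to
   m (see modinvP); the value for other x is irrelevant. *)
Definition modinv (m x : nat) : nat := (egcdn x m).1 %% m.

Lemma modinvP (m x : nat) :
  0 < x -> coprime x m -> x * modinv m x = 1 %[mod m].
Proof.
rewrite /modinv => x_gt0 /eqP co_xm; rewrite modnMmr.
case: egcdnP => //= km kn; rewrite co_xm mulnC => -> _.
by rewrite modnMDl.
Qed.

Lemma modinv_lt (m x : nat) : 0 < m -> modinv m x < m.
Proof. by move=> m_gt0; rewrite ltn_mod. Qed.

(* The variables x_1, ..., x_2k, indexed from 0, range over {0, ..., N}; being
   prime they lie in [1, N]. *)
Definition recip_solutions (m k N : nat) : {set {ffun 'I_(2 * k) -> 'I_N.+1}} :=
  [set x : {ffun 'I_(2 * k) -> 'I_N.+1} |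
           [forall i, prime (x i) && coprime (x i) m] &&
           (\sum_(i < 2 * k | i < k) modinv m (x i) ==
            \sum_(i < 2 * k | k <= i) modinv m (x i) %[mod m])].

Definition J (m k N : nat) : nat := #|recip_solutions m k N|.

(* Main.v *)
(** Fix [x_1, ..., x_k]. A tuple [y] of primes with [\sum 1/y_i = c] modulo [m]
gives a point [(A, B)], with [B = \prod y_i] and [A = B * \sum 1/y_i], such that
[A = c B] modulo [m]. For two such points, [A B'] and [A' B] are congruent
modulo [m], so distinct slopes [B/A] differ by at least [m/L^2], where
[L = k N^(k-1)] bounds [A]. Since [B/A <= N/k], there are at most
[k N^(2k-1)/m + 1] slopes. Tuples with equal slopes have equal sums
[\sum 1/y_i] in [rat], hence the same prime entries larger than [k]: a prime
[p > k] occurring in [y] occurs [a] times with [0 < a < p], and so divides the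
denominator of the sum. Hence each slope contributes at most [(2k)^k] tuples.
Finally there are at most [2N/3] primes up to [N], and [k (2/3)^k < 1]. *)

Require Import Defs.
From mathcomp Require Import all_boot all_order all_algebra.
From mathcomp Require Import zify ring lra.
Import Order.TTheory GRing.Theory Num.Theory.

Set Implicit Arguments.
Unset Strict Implicit.
Unset Printing Implicit Defensive.

Lemma leq_card_fibers (aT rT : finType) (f : aT -> rT) (A : {set aT})
    (B : {set rT}) (M : nat) :
  (forall x, x \in A -> f x \in B) ->
  (forall b, b \in B -> #|[set x in A | f x == b]| <= M) ->
  #|A| <= #|B| * M.
Proof.
move=> fAB fib; rewrite -sum1_card (partition_big f (mem B)) //=.
rewrite -sum_nat_const; apply: leq_sum => b bB.
apply: leq_trans (fib b bB); rewrite sum1dep_card.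
by apply: eq_leq; apply: eq_card => x; rewrite !inE.
Qed.

(** * Sums of reciprocals with cleared denominators *)

Section ReciprocalNumerator.

Variable I : finType.
Implicit Types (y z : I -> nat) (m p N : nat).

(** The integer [A] of the point [(A, B)]: the numerator of the sum of the [1/y_i] over the
    unreduced denominator [\prod y_i]. *)
Definition recip_num y := \sum_i \prod_(j | j != i) y j.

Lemma mul_prod_neq y i : y i * \prod_(j | j != i) y j = \prod_j y j.
Proof. by rewrite [RHS](bigD1 i). Qed.

Lemma recip_num_gt0 y : 0 < #|I| -> (forall i, 0 < y i) -> 0 < recip_num y.
Proof.
move=> /card_gt0P[i _] y0; rewrite /recip_num (bigD1 i) //=.
by rewrite addn_gt0 prodn_gt0.
Qed.

Lemma recip_num_le y N :
  (forall i, y i <= N) -> recip_num y <= #|I| * N ^ #|I|.-1.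
Proof.
move=> yN; rewrite -sum_nat_const; apply: leq_sum => i _.
have -> : #|I|.-1 = #|[pred j | j != i]| by rewrite -(cardC1 i).
by rewrite -prod_nat_const; apply: leq_prod.
Qed.

(** Each summand of [A] is [B / y_i], hence at least [B / N]. This bounds the slope [B/A]. *)
Lemma card_mul_prod_le y N :
  (forall i, y i <= N) -> #|I| * \prod_j y j <= N * recip_num y.
Proof.
move=> yN; rewrite -sum_nat_const big_distrr /=; apply: leq_sum => i _.
by rewrite -(mul_prod_neq y i) leq_mul2r yN orbT.
Qed.

Lemma recip_num_modinv y m :
  (forall i, 0 < y i) -> (forall i, coprime (y i) m) ->
  recip_num y = (\sum_i modinv m (y i)) * \prod_j y j %[mod m].
Proof.
move=> y0 co_ym; rewrite big_distrl /= /recip_num.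
rewrite -modn_summ -[in RHS]modn_summ; congr (_ %% m); apply: eq_bigr => i _.
rewrite -(mul_prod_neq y i) mulnA [modinv _ _ * _]mulnC -modnMml.
by rewrite modinvP // modnMml mul1n.
Qed.

(** If [c] is the common sum of inverses, both sides are [c] times the product of all entries of [y]
    and [z] modulo [m]. *)
Lemma cross_recip_num_modn y z m :
  (forall i, 0 < y i) -> (forall i, coprime (y i) m) ->
  (forall i, 0 < z i) -> (forall i, coprime (z i) m) ->
  \sum_i modinv m (y i) = \sum_i modinv m (z i) %[mod m] ->
  recip_num y * \prod_j z j = recip_num z * \prod_j y j %[mod m].
Proof.
move=> y0 yco z0 zco e.
rewrite -modnMml recip_num_modinv // modnMml -[RHS]modnMml.
rewrite [recip_num z %% m]recip_num_modinv // modnMml.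
by rewrite -!mulnA -modnMml e modnMml [\prod_j y j * _]mulnC.
Qed.

Lemma recip_num_ratE y : (forall i, 0 < y i) ->
  ((recip_num y)%:R = (\prod_j y j)%:R * \sum_i (y i)%:R^-1 :> rat)%R.
Proof.
move=> y0; rewrite /recip_num natr_sum mulr_sumr; apply: eq_bigr => i _.
rewrite -(mul_prod_neq y i) natrM mulrAC divff ?mul1r //.
by rewrite pnatr_eq0 -lt0n.
Qed.

Lemma large_prime_mem y z p :
  (forall i, prime (y i)) -> (forall i, prime (z i)) ->
  recip_num y * \prod_j z j = recip_num z * \prod_j y j ->
  #|I| < p -> p \in codom y -> p \in codom z.
Proof.
move=> py pz e Ip p_in_y; apply: contraT => p_nz.
have [i0 pE] := codomP p_in_y; have pp : prime p by rewrite pE.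
have y0 i : 0 < y i by exact: prime_gt0.
have z0 i : 0 < z i by exact: prime_gt0.
have sumE : (\sum_i (y i)%:R^-1 = \sum_i (z i)%:R^-1 :> rat)%R.
  have nz t : (forall i, 0 < t i) -> ((\prod_(j : I) t j)%:R != 0 :> rat)%R.
    by move=> t0; rewrite pnatr_eq0 -lt0n prodn_gt0.
  move/(congr1 (fun n => n%:R : rat)%R): e.
  rewrite !natrM !recip_num_ratE // => e.
  apply: (mulfI (mulf_neq0 (nz _ y0) (nz _ z0))); rewrite mulrAC e; ring.
pose U := \prod_(i | y i != p) y i.
pose V := \prod_i z i.
have dvdU i : y i != p -> y i %| U by move=> h; rewrite /U (bigD1 i) // dvdn_mulr.
have dvdV i : z i %| V by rewrite /V (bigD1 i) // dvdn_mulr.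
have co_pU : coprime p U.
  rewrite /U; apply: (big_ind (fun v => coprime p v)) => [|u v|i yp].
  - exact: coprimen1.
  - by rewrite coprimeMr => -> ->.
  - by rewrite prime_coprime // dvdn_prime2 // eq_sym.
have co_pV : coprime p V.
  rewrite /V; apply: (big_ind (fun v => coprime p v)) => [|u v|i _].
  - exact: coprimen1.
  - by rewrite coprimeMr => -> ->.
  - rewrite prime_coprime // dvdn_prime2 //.
    by apply: contraNN p_nz => /eqP->; apply: codom_f.
(* Multiply the two equal sums of reciprocals by [p * U * V]: an entry of [y] equal to [p] gives
   [U * V], every other term is a multiple of [p]. So [p] divides the number of occurrences of [p]
   in [y], which lies between 1 and [#|I| < p]. *)
have natE : #|[pred i | y i == p]| * (U * V) + p * \sum_(i | y i != p) U %/ y i * V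
    = p * \sum_i V %/ z i * U.
  apply: (@mulrIn rat 1%R) => //; rewrite -[LHS]/(_%:R)%R -[RHS]/(_%:R)%R.
  have pr0 : (p%:R != 0 :> rat)%R by rewrite pnatr_eq0 -lt0n prime_gt0.
  have -> : ((p * \sum_i V %/ z i * U)%:R
             = p%:R * U%:R * V%:R * \sum_i (z i)%:R^-1 :> rat)%R.
    rewrite natrM natr_sum !mulr_sumr.
    apply: eq_bigr => i _; rewrite natrM natf_div //; ring.
  rewrite -sumE [in RHS](bigID (fun i => y i == p)) /= mulrDr natrD.
  congr (_ + _)%R.
    rewrite (eq_bigr (fun=> p%:R^-1)%R) => [|i /eqP-> //].
    rewrite sumr_const !natrM -mulr_natr; field; exact: pr0.
  rewrite natrM natr_sum !mulr_sumr.
  apply: eq_bigr => i h; rewrite natrM natf_div ?dvdU //; ring.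
have : p %| #|[pred i | y i == p]| * (U * V).
  by rewrite -(dvdn_addl _ (dvdn_mulr (\sum_(i | y i != p) U %/ y i * V) (dvdnn p)))
    natE dvdn_mulr.
rewrite Gauss_dvdl ?coprimeMr ?co_pU ?co_pV // => /dvdn_leq p_le.
have /p_le : 0 < #|[pred i | y i == p]|.
  by apply/card_gt0P; exists i0; rewrite inE pE.
by rewrite leqNgt (leq_ltn_trans (max_card _) Ip).
Qed.

End ReciprocalNumerator.

(** * Separation of slopes *)

Lemma divn_slope_inj A1 B1 A2 B2 L m :
  0 < m -> 0 < A1 <= L -> 0 < A2 <= L -> A1 * B2 = A2 * B1 %[mod m] ->
  (B1 * L ^ 2) %/ (A1 * m) = (B2 * L ^ 2) %/ (A2 * m) -> A1 * B2 = A2 * B1.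
Proof.
move=> m0; wlog le12 : A1 B1 A2 B2 / A1 * B2 <= A2 * B1.
  move=> W; case: (leqP (A1 * B2) (A2 * B1)) => [|/ltnW] le A1L A2L em eq.
    exact: W.
  by apply/esym/W.
move=> /andP[A1_gt0 A1L] /andP[A2_gt0 A2L] /eqP em eq.
apply/eqP; rewrite eqn_leq le12 /= leqNgt; apply/negP => lt12.
have ge_m : A1 * B2 + m <= A2 * B1.
  move: em; rewrite eq_sym eqn_mod_dvd // => /dvdn_leq.
  rewrite subn_gt0 => /(_ lt12).
  by lia.
(* The gap [ge_m] makes the slopes scaled by [L^2/m] differ by at least [L^2/(A1 A2)], which is at
   least 1, so they cannot share the integer part [q]. *)
pose q := (B1 * L ^ 2) %/ (A1 * m).
have q_lt : B1 * L ^ 2 < q.+1 * (A1 * m) by rewrite ltn_ceil // muln_gt0 A1_gt0.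
have q_le : q * (A2 * m) <= B2 * L ^ 2 by rewrite /q eq leq_divM.
have LL : A1 * A2 * m <= L ^ 2 * m by rewrite leq_mul2r -mulnn leq_mul ?orbT.
have := leq_mul ge_m (leqnn (L ^ 2)).
have : A1 * (q * (A2 * m)) <= A1 * (B2 * L ^ 2) by rewrite leq_mul2l q_le orbT.
have : A2 * (B1 * L ^ 2) < A2 * (q.+1 * (A1 * m)) by rewrite ltn_mul2l A2_gt0.
by nia.
Qed.

(** * Counting primes by parity *)

Lemma sum_primes_le n : \sum_(0 <= i < n.*2.+3) prime i <= n.+1.
Proof.
elim: n => [|n IHn]; first by rewrite unlock.
rewrite doubleS big_nat_recr // big_nat_recr //=.
have -> : prime n.*2.+4 = false.
  by apply/negP => /even_prime[] //=; rewrite odd_double.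
by rewrite addn0 -[n.+2]addn1 leq_add // leq_b1.
Qed.

(** Only 2 and odd numbers from 3 on can be prime, so for [N >= 2] the count is at most [(N+1)/2],
    rounded down. The ratio 2/3 is reached at [N = 3]. *)
Lemma card_primes_le N m :
  3 * #|[set i : 'I_N.+1 | prime i && coprime i m]| <= 2 * N.
Proof.
have le : #|[set i : 'I_N.+1 | prime i && coprime i m]|
    <= \sum_(0 <= i < N.+1) prime i.
  rewrite big_mkord -sum1_card big_mkcond leq_sum // => i _.
  by rewrite inE; case: (prime i); case: coprime.
case: N le => [|[|M]] le;
  try by move: (leq_mul (leqnn 3) le) => /leq_trans-> //; rewrite unlock.
(* [n] is [M/2] rounded up, which extends the range to the shape of [sum_primes_le]. *)
set n := M./2 + odd M; have Nn : M.+3 <= n.*2.+3.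
  by rewrite -[M in leqLHS]odd_double_half /n doubleD; case: odd; lia.
have mono : \sum_(0 <= i < M.+3) prime i <= \sum_(0 <= i < n.*2.+3) prime i.
  by rewrite [leqRHS](big_cat_nat (n := M.+3)) //= leq_addr.
have := sum_primes_le n; move: (odd_double_half M) le mono; rewrite /n.
by case: odd => /=; lia.
Qed.

(** * The two halves of the index set *)

Section Halves.

Variable k : nat.

Definition lo_ord (i : 'I_k) : 'I_(2 * k) :=
  widen_ord (leq_pmull k (isT : 0 < 2)) i.

Lemma hi_ord_subproof (i : 'I_k) : k + i < 2 * k.
Proof. by rewrite mul2n -addnn ltn_add2l. Qed.

Definition hi_ord (i : 'I_k) : 'I_(2 * k) := Ordinal (hi_ord_subproof i).

Lemma half_ordP (i : 'I_(2 * k)) :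
  (exists j, i = lo_ord j) \/ (exists j, i = hi_ord j).
Proof.
case: (ltnP i k) => ik; first by left; exists (Ordinal ik); apply: val_inj.
have ik' : i - k < k by move: (ltn_ord i); lia.
by right; exists (Ordinal ik'); apply: val_inj; rewrite /= subnKC.
Qed.

Lemma lo_ord_inj : injective lo_ord.
Proof. by move=> i j /(congr1 val) /= ij; apply: val_inj. Qed.

Lemma hi_ord_inj : injective hi_ord.
Proof. by move=> i j /(congr1 val) /= /addnI ij; apply: val_inj. Qed.

Lemma sum_lo_ord (F : 'I_(2 * k) -> nat) :
  \sum_(i < 2 * k | i < k) F i = \sum_j F (lo_ord j).
Proof.
transitivity (\sum_(i in [set lo_ord j | j in [set: 'I_k]]) F i).
  apply: eq_bigl => i; apply/idP/imsetP => [ik|[j _ ->] /=]; last exact: ltn_ord.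
  by exists (Ordinal ik) => //; apply: val_inj.
rewrite big_imset /=; last by move=> i j _ _; apply: lo_ord_inj.
by apply: eq_bigl => j; rewrite inE.
Qed.

Lemma sum_hi_ord (F : 'I_(2 * k) -> nat) :
  \sum_(i < 2 * k | k <= i) F i = \sum_j F (hi_ord j).
Proof.
transitivity (\sum_(i in [set hi_ord j | j in [set: 'I_k]]) F i).
  apply: eq_bigl => i; apply/idP/imsetP => [ki|[j _ ->] /=]; last exact: leq_addr.
  have [[j ij]|[j ->]] := half_ordP i; last by exists j.
  by move: ki; rewrite ij /= leqNgt ltn_ord.
rewrite big_imset /=; last by move=> i j _ _; apply: hi_ord_inj.
by apply: eq_bigl => j; rewrite inE.
Qed.

End Halves.

(** * Counting solutions by first half and slope *)

Lemma card_slope_fiber (k N : nat) (y0 : 'I_k -> 'I_N.+1)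
    (S : {set {ffun 'I_k -> 'I_N.+1}}) :
  (forall i, prime (y0 i)) ->
  (forall y, y \in S -> (forall i, prime (y i)) /\
     recip_num (fun i => y i) * \prod_j y0 j
     = recip_num (fun i => y0 i) * \prod_j y j) ->
  #|S| <= (2 * k) ^ k.
Proof.
move=> pr0 prS.
(* Every entry is at most [k] or an entry of [y0]. Where [i.+1] exceeds [N], [inord] returns a
   default, which is harmless for an upper bound. *)
pose Q := [set inord i.+1 | i : 'I_k] :|: [set y0 i | i : 'I_k] : {set 'I_N.+1}.
have cardQ : #|Q| <= 2 * k.
  rewrite mul2n -addnn (leq_trans (leq_card_setU _ _)) // -[X in _ <= X + X]card_ord.
  by rewrite leq_add // leq_imset_card.
have SQ : S \subset ffun_on Q.
  apply/subsetP => y /prS[pry e]; apply/ffun_onP => i.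
  rewrite inE; case: (leqP (y i) k) => [yk|ky].
    have y_gt0 : 0 < y i := prime_gt0 (pry i).
    have yk' : (y i).-1 < k by rewrite prednK.
    apply/orP; left; apply/imsetP; exists (Ordinal yk') => //=.
    by rewrite prednK // inord_val.
  apply/orP; right; apply/imsetP.
  have /codomP[j yj] : (y i : nat) \in codom (fun j => y0 j : nat).
    apply: (large_prime_mem (y := fun i => y i)) => //.
      by rewrite card_ord.
    exact: (codom_f (fun i => y i : nat)).
  by exists j => //; apply: val_inj.
apply: leq_trans (subset_leq_card SQ) _.
rewrite card_ffun_on card_ord; have [k0|k_gt0] := posnP k.
  by rewrite [X in _ ^ X <= _]k0 [X in _ <= _ ^ X]k0.
by rewrite leq_exp2r.
Qed.

Lemma J_le m k N : 0 < m -> 0 < k ->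
  J m k N <= #|[set i : 'I_N.+1 | prime i && coprime i m]| ^ k
             * (k * N ^ (2 * k - 1) %/ m).+1 * (2 * k) ^ k.
Proof.
move=> m0 k0; set P := [set i | _]; set K := _ %/ m.
pose lo (x : {ffun 'I_(2 * k) -> 'I_N.+1}) := [ffun j => x (lo_ord j)].
pose hi (x : {ffun 'I_(2 * k) -> 'I_N.+1}) := [ffun j => x (hi_ord j)].
pose L := k * N ^ k.-1.
(* [B/A] scaled by [L^2/m] and rounded down, as in [divn_slope_inj]. *)
pose slope (y : {ffun 'I_k -> 'I_N.+1}) :=
  (\prod_j y j * L ^ 2) %/ (recip_num (fun i => y i) * m).
(* [inord] is faithful on solutions by [slope_le]. *)
pose f x := (lo x, inord (slope (hi x)) : 'I_K.+1).
have yN (y : {ffun 'I_k -> 'I_N.+1}) i : y i <= N by rewrite -ltnS.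
have hiP x : x \in recip_solutions m k N ->
    (forall i, prime (hi x i)) /\ (forall i, coprime (hi x i) m).
  rewrite inE => /andP[/forallP h _].
  by split=> i; rewrite ffunE; case/andP: (h (hi_ord i)).
have numP x : x \in recip_solutions m k N ->
    0 < recip_num (fun i => hi x i) <= L.
  move=> /hiP[pr _]; rewrite recip_num_gt0 ?card_ord //=; last first.
    by move=> i; apply: prime_gt0.
  rewrite /L -[in leqRHS](card_ord k); apply: recip_num_le => i; exact: yN.
have slope_le x : x \in recip_solutions m k N -> slope (hi x) <= K.
  move=> xS; have /andP[A0 _] := numP x xS.
  rewrite /slope /K -[leqRHS](divnMl A0) leq_div2r //.
  have := card_mul_prod_le (yN (hi x)); rewrite card_ord.
  move: (recip_num _) (\prod_j _) => A B.
  have -> : L ^ 2 = k * (k * (N ^ (k.-1 + k.-1))) by rewrite /L expnD; lia.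
  have -> : N ^ (2 * k - 1) = N * N ^ (k.-1 + k.-1).
    by rewrite -expnS; congr (_ ^ _); lia.
  move: (N ^ _) => T /(leq_mul (leqnn (k * T))); lia.
rewrite -mulnA [_ * (_ ^ _)]mulnC.
apply: leq_trans (leq_card_fibers (f := f)
  (B := setX [set u in ffun_on P] [set: 'I_K.+1]) (M := (2 * k) ^ k) _ _) _.
- move=> x; rewrite !inE andbT /= => /andP[/forallP h _].
  by apply/ffun_onP => i; rewrite ffunE inE h.
- move=> [u q] _; set F := [set x in _ | _].
  have [->|[x0 x0F]] := set_0Vmem F; first by rewrite cards0.
  have FP x : x \in F -> [/\ x \in recip_solutions m k N, lo x = u &
                           slope (hi x) = slope (hi x0)].
    have val_q z : z \in F -> [/\ z \in recip_solutions m k N, lo z = u &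
                               slope (hi z) = q].
      rewrite [z \in F]inE => /andP[zS /eqP[<- <-]]; split=> //.
      by rewrite inordK // ltnS slope_le.
    by move=> /val_q[? ? ->]; have [_ _ ->] := val_q x0 x0F.
  have [x0S lo_x0 _] := FP x0 x0F; have [pr0 co0] := hiP x0 x0S.
  have hi_inj : {in F &, injective hi}.
    move=> x x' /FP[_ lx _] /FP[_ lx' _] hxx'; apply/ffunP => i.
    have [[j ->]|[j ->]] := half_ordP i.
      by move: lx; rewrite -lx' => /ffunP/(_ j); rewrite !ffunE.
    by move: hxx' => /ffunP/(_ j); rewrite !ffunE.
  rewrite -(card_in_imset hi_inj); apply: (card_slope_fiber (y0 := hi x0)) => //.
  move=> _ /imsetP[x /FP[xS lo_x slope_x] ->]; have [pr co] := hiP x xS.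
  split=> //; apply: (@divn_slope_inj _ _ _ _ L m); rewrite ?numP //.
  apply: cross_recip_num_modn => // [i|i|]; try exact: prime_gt0.
  (* The congruence turns the sum over the second half into the one over [u], so the whole fibre
     shares one class [c]. *)
  have modS z : z \in recip_solutions m k N -> lo z = u ->
      \sum_i modinv m (hi z i) = \sum_i modinv m (u i) %[mod m].
    rewrite inE => /andP[_ /eqP]; rewrite sum_lo_ord sum_hi_ord => e <-.
    transitivity ((\sum_j modinv m (z (hi_ord j))) %% m).
      by congr (_ %% m); apply: eq_bigr => i _; rewrite ffunE.
    by rewrite -e; congr (_ %% m); apply: eq_bigr => i _; rewrite ffunE.
  by rewrite !modS.
by rewrite cardsX cardsT card_ord cardsE card_ffun_on card_ord; lia.
Qed.

(** * The numerical constants *)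

Local Open Scope ring_scope.

Lemma mulr_exp_twothirds_lt1 (k : nat) : k%:R * (2 / 3) ^+ k < 1 :> rat.
Proof.
have ge0 : 0 <= 2 / 3 :> rat by lra.
have step (x y : rat) : 0 <= x * y -> (x + 3) * (2 / 3 * y) <= (x + 2) * y.
  by lra.
(* From [k = 2] on, [k (2/3)^k] does not increase, and its value at 2 is 8/9. *)
have h n : (n%:R + 2) * (2 / 3) ^+ n.+2 <= 8 / 9 :> rat.
  elim: n => [|n IHn]; first by rewrite expr2; lra.
  apply: le_trans IHn; rewrite [_ ^+ n.+3]exprS -natr1 -addrA.
  have -> : 1 + 2 = 3 :> rat by lra.
  exact: step (mulr_ge0 (ler0n _ n) (exprn_ge0 n.+2 ge0)).
case: k => [|[|k]]; first by rewrite mul0r.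
  by rewrite expr1; lra.
by rewrite -addn2 natrD addn2; apply: le_lt_trans (h k) _; lra.
Qed.

Theorem theorem2 :
  exists m0 : nat, forall m k N : nat,
    (0 < m)%N -> (m0 <= m)%N -> (1 <= k)%N -> (1 <= N)%N ->
    (J m k N)%:R <
      (2 * k)%:R ^+ k * (N%:R ^+ (2 * k - 1) / m%:R + 1) * N%:R ^+ k :> rat.
Proof.
exists 0%N => m k N m0 _ k0 N0.
have := J_le N m0 k0; have := card_primes_le N m.
set P := #|_| => P_le J_leq.
set X := N%:R ^+ (2 * k - 1) / m%:R.
have X0 : 0 <= X by rewrite divr_ge0 ?exprn_ge0.
have K_le : ((k * N ^ (2 * k - 1) %/ m).+1)%:R <= k%:R * (X + 1) :> rat.
  rewrite -addn1 natrD mulrDr mulr1 lerD ?ler1n //.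
  rewrite /X mulrA ler_pdivlMr ?ltr0n // -natrX -!natrM ler_nat; exact: leq_divM.
have P_pow : (P ^ k)%:R <= (2 / 3) ^+ k * N%:R ^+ k :> rat.
  rewrite natrX -exprMn lerXn2r ?nnegrE ?mulr_ge0 //.
  by move: P_le; rewrite -(ler_nat rat) !natrM; lra.
have kk0 : 0 < (2 * k)%:R ^+ k :> rat by rewrite exprn_gt0 // ltr0n muln_gt0.
have Nk0 : 0 < N%:R ^+ k :> rat by rewrite exprn_gt0 // ltr0n.
apply: (@le_lt_trans _ _ ((P ^ k * (k * N ^ (2 * k - 1) %/ m).+1 * (2 * k) ^ k)%:R)).
  by rewrite ler_nat.
rewrite !natrM [((2 * k) ^ k)%:R]natrX -[2%:R * k%:R]natrM.
rewrite mulrC -[ltRHS]mulrA ltr_pM2l //.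
apply: le_lt_trans (ler_pM (ler0n _ _) (ler0n _ _) P_pow K_le) _.
(* The density of primes pays for the factor [k] from the number of slopes and makes the inequality
   strict. *)
have -> : (2 / 3) ^+ k * N%:R ^+ k * (k%:R * (X + 1))
        = k%:R * (2 / 3) ^+ k * ((X + 1) * N%:R ^+ k) :> rat by ring.
rewrite -[ltRHS]mul1r ltr_pM2r ?mulr_exp_twothirds_lt1 //.
by rewrite mulr_gt0 // ltr_wpDl.
Qed.
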